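(* Let $c_n(t)$ denote the value at $q=-1$ of the $q$-Narayana polynomial $C_n(t;q)$. The generating function $$c(t,z)=\sum_{n\ge 0}c_n(t)z^n$$ has the continued fraction expansion of Jacobi type $$c(t,z)=\cfrac{1}{1-s_0z-\cfrac{t_0z^2}{1-s_1z-\cfrac{t_1z^2}{1-\ddots}}}$$ with $s_0=1$, $s_n=(-1)^n(1-t)$ for all $n\ge 1$, and $t_n=t$ for all $n\ge 0$.
   Context: Notation: $[n]=[n]_q=\sum_{j=0}^{n-1}q^j$, $[n]!=\prod_{j=1}^n[j]$, and $\begin{bmatrix}n\\k\end{bmatrix}=\frac{[n]!}{[k]!\,[n-k]!}$ for $0\le k\le n$ (and $0$ otherwise). For $n\ge 1$ the $q$-Narayana polynomials are $$C_n(t;q)=\sum_{k=0}^{n-1}q^{k^2+k}\begin{bmatrix}n\\k\end{bmatrix}\begin{bmatrix}n-1\\k\end{bmatrix}\frac{t^k}{[k+1]},$$ and $c_n(t)=\lim_{q\to-1}C_n(t;q)$ (coefficientwise in $t$); by convention $c_0(t)=1$. For example, $c_1(t)=1$, $c_2(t)=1+t$, $c_3(t)=1+t+t^2$, $c_4(t)=1+2t+2t^2+t^3$. Generating functions are formal power series in $z$ with coefficients in $\mathbb{Z}[t]$. The continued fraction is understood as a formal power series in $z$ (the $z$-adic limit of its finite truncations). Here $t$ is the polynomial variable, while $t_0,t_1,\dots$ (with indices) are the continued fraction coefficients. *)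

(* Defs.v *)
(* MathComp world, with MathComp-Analysis for the limit q -> -1. *)
From mathcomp Require Import all_boot all_order all_algebra.
From mathcomp Require Import all_classical all_reals all_analysis.

Set Implicit Arguments.
Unset Strict Implicit.
Unset Printing Implicit Defensive.

Import Order.TTheory GRing.Theory Num.Theory.
Import numFieldNormedType.Exports.
Local Open Scope classical_set_scope.
Local Open Scope ring_scope.

Definition qint (F : fieldType) (q : F) (n : nat) : F := \sum_(j < n) q ^+ j.

Definition qfact (F : fieldType) (q : F) (n : nat) : F :=
  \prod_(1 <= j < n.+1) qint q j.

Definition qbinom (F : fieldType) (q : F) (n k : nat) : F :=
  if (k <= n)%N then qfact q n / (qfact q k * qfact q (n - k)) else 0.

(* 'X is the variable t; only n >= 1 is meaningful. *)
Definition qNarayana (F : fieldType) (n : nat) (q : F) : {poly F} :=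
  \sum_(k < n) (q ^+ (k ^ 2 + k) * qbinom q n k * qbinom q n.-1 k
                / qint q k.+1) *: 'X^k.

(* At a real q != -1 no [j] with j >= 1 vanishes, so every division in
   qNarayana n q is a genuine one on the punctured neighbourhoods (-1)^'. At
   q = -1 itself the formula is of the form 0 / 0, whence the limit, which is
   taken in each coefficient. *)
Definition qNarayana_m1 (R : realType) (n : nat) : {poly R} :=
  if n is 0%N then 1
  else \poly_(k < n) lim ((qNarayana n q)`_k @[q --> (-1 : R)^']).

(* A formal power series in z is its sequence of coefficients. *)
Definition fps (A : nzRingType) : Type := nat -> A.

Section FormalPowerSeries.
Variable A : nzRingType.
Implicit Types f g : fps A.

Definition fps_const (a : A) : fps A := fun n => if n is 0%N then a else 0.

Definition fps_add f g : fps A := fun n => f n + g n.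

Definition fps_mul f g : fps A := fun n => \sum_(i < n.+1) f i * g (n - i)%N.

Definition fps_exp f (k : nat) : fps A := iter k (fps_mul f) (fps_const 1).

(* a z^k *)
Definition fps_monom (a : A) (k : nat) : fps A :=
  fun n => if n == k then a else 0.

(* 1 / (1 - f) = \sum_k f^k, for f with zero constant term: f^k then has no
   term of degree < k, so only k <= n contribute to the coefficient of z^n. *)
Definition fps_geom f : fps A := fun n => \sum_(k < n.+1) fps_exp f k n.

(* Truncation after N levels, with the remaining tail replaced by 0, of
     1 / (1 - s_k z - t_k z^2 / (1 - s_{k+1} z - t_{k+1} z^2 / ...)). *)
Fixpoint jfrac_trunc (s t : nat -> A) (k N : nat) : fps A :=
  if N is N'.+1 then
    fps_geom (fps_add (fps_monom (s k) 1)
                      (fps_mul (fps_monom (t k) 2) (jfrac_trunc s t k.+1 N')))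
  else fps_const 0.

(* f is the z-adic limit of the truncations: each coefficient is eventually
   constant, equal to that of f. *)
Definition has_jfrac f (s t : nat -> A) : Prop :=
  forall n : nat, \forall N \near \oo, jfrac_trunc s t 0 N n = f n.

End FormalPowerSeries.

(* Main.v *)
(* At q = -1 the coefficient of t^k in C_n is
   'C(n./2, uphalf k) * 'C((n-1)./2, k./2): for odd k the factor 1 / [k+1] is
   moved by absorption to 1 / [n] or 1 / [n-k], whichever has an odd index.
   Hence c_n(t) is the sum of the coefficients of x^0 and x^1 in
   (1 + t x)^(n./2) (1 + t / x)^((n-1)./2). By Flajolet's theory the continued
   fraction enumerates weighted Motzkin paths; the weight of the paths of length
   n ending at height k is the sum of the coefficients of x^j and x^(j+1) in the
   same product, with j about k/2, because these sums obey the recurrence of the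
   paths, the parities of n and k alternating the two factors. *)
Require Import Defs.
From mathcomp Require Import all_boot all_order all_algebra.
From mathcomp Require Import all_classical all_reals all_analysis.
From mathcomp Require Import ring zify.

Import GRing.Theory.
Local Open Scope ring_scope.

(** * Formal power series and continued fractions as generating functions of paths *)

Section FormalPowerSeriesTheory.
Variable A : comNzRingType.
Implicit Types f g h : fps A.

(** Transfers commutativity and associativity from [{poly A}] to series. *)
Lemma fps_mulE f g N n : (n < N)%N ->
  fps_mul f g n = ((\poly_(i < N) f i) * (\poly_(i < N) g i))`_n.
Proof.
move=> ltnN; rewrite coefM; apply: eq_bigr => i _.
by rewrite !coef_poly !(leq_ltn_trans _ ltnN) ?leq_subr // -ltnS.
Qed.

Lemma fps_mulC f g : fps_mul f g = fps_mul g f.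
Proof. by apply/funext => n; rewrite !(@fps_mulE _ _ n.+1) // mulrC. Qed.

Lemma fps_mulA f g h : fps_mul f (fps_mul g h) = fps_mul (fps_mul f g) h.
Proof.
apply/funext => n; rewrite !(@fps_mulE _ _ n.+1) //.
set tr := fun e : fps A => \poly_(i < n.+1) e i.
have tr_mul e e' i : (i < n.+1)%N -> (tr (fps_mul e e'))`_i = (tr e * tr e')`_i.
  by move=> lti; rewrite coef_poly lti (@fps_mulE _ _ n.+1).
transitivity ((tr f * (tr g * tr h))`_n); last rewrite mulrA.
  rewrite [LHS]coefM [RHS]coefM; apply: eq_bigr => i _.
  by rewrite tr_mul // ltnS leq_subr.
rewrite [LHS]coefM [RHS]coefM; apply: eq_bigr => i _.
by rewrite tr_mul.
Qed.

Lemma fps_mulDl f g h :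
  fps_mul (fps_add f g) h = fps_add (fps_mul f h) (fps_mul g h).
Proof.
apply/funext => n; rewrite /fps_add /fps_mul -big_split /=.
by apply: eq_bigr => i _; rewrite mulrDl.
Qed.

Lemma fps_monomM (a : A) k f n :
  fps_mul (fps_monom a k) f n = if (k <= n)%N then a * f (n - k)%N else 0.
Proof.
rewrite /fps_mul /fps_monom; case: leqP => [lekn|ltnk].
  rewrite (bigD1 (Ordinal (lekn : k < n.+1)%N)) //= eqxx big1 ?addr0 // => i.
  by rewrite -val_eqE /= => /negbTE->; rewrite mul0r.
rewrite big1 // => i _; rewrite ifN ?mul0r //.
by rewrite neq_ltn (leq_trans _ ltnk).
Qed.

Lemma fps_monom1M (a : A) f n : fps_mul (fps_monom a 1) f n.+1 = a * f n.
Proof. by rewrite fps_monomM subn1. Qed.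

Lemma fps_monomMM (a b : A) k l :
  fps_mul (fps_monom a k) (fps_monom b l) = fps_monom (a * b) (k + l).
Proof.
apply/funext => n; rewrite fps_monomM /fps_monom; case: leqP => [lekn|ltnk].
  rewrite -[in RHS](subnKC lekn) eqn_add2l.
  by case: eqP => _; rewrite ?mulr0.
by rewrite ifN // neq_ltn (leq_trans ltnk) ?leq_addr.
Qed.

Lemma fps_const1M f : fps_mul (fps_const 1) f = f.
Proof.
apply/funext => n; rewrite /fps_mul big_ord_recl /= mul1r subn0 big1 ?addr0 //.
by move=> i _; rewrite mul0r.
Qed.

Lemma fps_exp_eq0 f k n : f 0 = 0 -> (n < k)%N -> fps_exp f k n = 0.
Proof.
move=> f0; elim: k n => // k IHk n ltnk.
rewrite /fps_exp iterS -/(fps_exp f k) /fps_mul big_ord_recl f0 mul0r add0r.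
rewrite big1 // => i _; rewrite IHk ?mulr0 //.
by rewrite /= /bump; have := ltn_ord i; lia.
Qed.

Lemma fps_geomE f : f 0 = 0 ->
  fps_geom f = fps_add (fps_const 1) (fps_mul f (fps_geom f)).
Proof.
move=> f0; apply/funext => n; rewrite /fps_geom /fps_add big_ord_recl.
congr (_ + _); rewrite [RHS]/fps_mul.
have -> : \sum_(i < n) fps_exp f (lift ord0 i) n =
    \sum_(j < n.+1) \sum_(i < n) f j * fps_exp f i (n - j)%N.
  by rewrite exchange_big; apply: eq_bigr.
apply: eq_bigr => -[[|j] ltj] _ /=.
  by rewrite f0 mul0r big1 // => i _; rewrite mul0r.
rewrite -mulr_sumr; congr (_ * _).
(* The added powers of [f] start beyond degree [n - j.+1]. *)
rewrite [RHS](big_ord_widen n (fun k => fps_exp f k (n - j.+1)%N)); last by lia.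
rewrite [RHS]big_mkcond; apply: eq_bigr => i _.
by case: ltnP => // ?; rewrite fps_exp_eq0.
Qed.

Lemma jfrac_truncS (s t : nat -> A) k N :
  jfrac_trunc s t k N.+1 =
  fps_add (fps_const 1)
    (fps_mul (fps_add (fps_monom (s k) 1)
                      (fps_mul (fps_monom (t k) 2) (jfrac_trunc s t k.+1 N)))
             (jfrac_trunc s t k N.+1)).
Proof. by apply: fps_geomE; rewrite /fps_add fps_monomM addr0. Qed.

(* M n k is the total weight of the Motzkin paths of length n from height 0 to
   height k, with weights u_k on up steps, s_k on level steps and d_k on down
   steps. *)
Lemma has_jfrac_paths (s t u d : nat -> A) (M : nat -> nat -> A) :
  (forall k, d k * u k = t k) ->
  (forall k, M 0 k = (k == 0)%:R) ->
  (forall n, M n.+1 0 = s 0 * M n 0 + d 0 * M n 1) ->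
  (forall n k, M n.+1 k.+1 =
     u k * M n k + s k.+1 * M n k.+1 + d k.+1 * M n k.+2) ->
  has_jfrac (fun n => M n 0) s t.
Proof.
move=> du M0 Mr0 MrS n.
(* The tail from level [k], with [N - k] levels so that it unfolds to [F N k.+1] for the same
   [N]. *)
pose F N k := jfrac_trunc s t k (N - k).
(* The generating function of the paths from 0 to k, split at their last
   visits to the heights 0, ..., k - 1. *)
pose fix H N k : fps A :=
  if k is k'.+1 then fps_mul (F N k) (fps_mul (fps_monom (u k') 1) (H N k'))
  else F N 0.
(* The equation of [F N k], with [t k] split into [d k * u k] and z^2 into one z per up or down
   step. *)
have FM N k h : (k < N)%N -> fps_mul (F N k) h =
    fps_add h (fps_add (fps_mul (fps_monom (s k) 1) (fps_mul (F N k) h))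
      (fps_mul (fps_monom (d k) 1) (fps_mul (F N k.+1)
         (fps_mul (fps_monom (u k) 1) (fps_mul (F N k) h))))).
  move=> ltkN; have FE : F N k = jfrac_trunc s t k (N - k.+1).+1.
    by rewrite /F subnSK.
  rewrite {1}FE jfrac_truncS -FE -/(F N k.+1).
  rewrite !fps_mulDl fps_const1M !fps_mulA; congr fps_add.
  congr fps_add; rewrite -!fps_mulA; rewrite [X in fps_mul _ X = _]fps_mulA.
  rewrite [in X in _ = fps_mul _ X]fps_mulA.
  rewrite [fps_mul (F N _) (fps_monom _ _)]fps_mulC.
  by rewrite !fps_mulA fps_monomMM du.
(* The bound survives the recurrence: [m] drops by one while the height rises by at most one. *)
have HE N m k : (m + k < N)%N -> H N k m = M m k.
  elim: m k => [|m IHm] [|k] ltN; rewrite ?M0 ?Mr0 ?MrS /=.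
  - have:= FM N 0 (fps_const 1) ltN; rewrite fps_mulC fps_const1M => ->.
    by rewrite /fps_add !fps_monomM /= !addr0.
  - by rewrite /fps_mul big_ord1 big_ord1 /fps_monom /= mul0r mulr0.
  - have:= FM N 0 (fps_const 1) (leq_trans (leqW (ltn0Sn _)) ltN).
    rewrite [fps_mul _ (fps_const 1)]fps_mulC fps_const1M => ->.
    rewrite /fps_add !fps_monom1M /= add0r.
    by rewrite -(IHm 0) -?(IHm 1) //; lia.
  rewrite FM; last by lia.
  rewrite /fps_add !fps_monom1M -[fps_mul (F N k.+1) _]/(H N k.+1).
  by rewrite -[fps_mul (F N k.+2) _]/(H N k.+2) !IHm ?addrA //; lia.
exists n.+1 => // N /= ltnN.
by rewrite -(HE N) ?addn0 //= /F subn0.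
Qed.

End FormalPowerSeriesTheory.

(** * Coefficients of binomial products and the path recurrence *)

Section BinomialProducts.
Variables (A : comNzRingType) (t : A).

(* The coefficient of x^j in (1 + t x)^m (1 + t / x)^p. *)
Definition bincoef m p j : A :=
  \sum_(i < p.+1) ('C(m, i + j) * 'C(p, i))%:R * t ^+ (i.*2 + j).

Lemma bincoef_widen N m p j : (p < N)%N ->
  bincoef m p j = \sum_(i < N) ('C(m, i + j) * 'C(p, i))%:R * t ^+ (i.*2 + j).
Proof.
move=> ltpN; pose F i : A := ('C(m, i + j) * 'C(p, i))%:R * t ^+ (i.*2 + j).
rewrite /bincoef (big_ord_widen N F ltpN) big_mkcond.
apply: eq_bigr => i _; case: ltnP => // ltpi.
by rewrite (bin_small ltpi) muln0 mul0r.
Qed.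

Lemma bincoefSl m p j :
  bincoef m.+1 p j.+1 = bincoef m p j.+1 + t * bincoef m p j.
Proof.
rewrite /bincoef mulr_sumr -big_split; apply: eq_bigr => i _ /=.
by rewrite !addnS binS mulnDl natrD exprS; ring.
Qed.

Lemma bincoefSr m p j :
  bincoef m p.+1 j = bincoef m p j + t * bincoef m p j.+1.
Proof.
rewrite (@bincoef_widen p.+2 m p j) // /bincoef !(big_ord_recl p.+1) -addrA.
congr (_ + _); first by rewrite !bin0.
rewrite mulr_sumr -big_split; apply: eq_bigr => i _.
rewrite !lift0 binS mulnDr natrD !addnS doubleS !addSn !exprS.
by rewrite /=; ring.
Qed.

(** Pascal's rule calls for the coefficient of x^(-1); with equal exponents the symmetry between x
    and 1/x turns it into that of x. *)
Lemma bincoefS0 m : bincoef m.+1 m 0 = bincoef m m 0 + t * bincoef m m 1.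
Proof.
rewrite (@bincoef_widen m.+2 m.+1) // (@bincoef_widen m.+2 m m 0) //.
rewrite /bincoef !(big_ord_recl m.+1) -addrA.
congr (_ + _); first by rewrite !bin0.
rewrite mulr_sumr -big_split; apply: eq_bigr => i _.
rewrite !lift0 !addn0 !addn1 binS mulnDl natrD doubleS !exprS.
by rewrite [in X in _ = _ + X]mulnC; ring.
Qed.

Definition bincoef2 m p j : A := bincoef m p j + bincoef m p j.+1.

Lemma bincoef2Sl m p j :
  bincoef2 m.+1 p j.+1 = bincoef2 m p j.+1 + t * bincoef2 m p j.
Proof. by rewrite /bincoef2 !bincoefSl; ring. Qed.

Lemma bincoef2Sr m p j :
  bincoef2 m p.+1 j = bincoef2 m p j + t * bincoef2 m p j.+1.
Proof. by rewrite /bincoef2 !bincoefSr; ring. Qed.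

Lemma bincoef2S0 m : bincoef2 m.+1 m 0 = (1 + t) * bincoef2 m m 0.
Proof. by rewrite /bincoef2 bincoefS0 bincoefSl; ring. Qed.

(* The total weight of the Motzkin paths of length n from height 0 to height k,
   with level weights 1 at height 0 and (-1)^k (1 - t) at height k > 0, up
   weights 1, t, 1, t, ... and down weights t, 1, t, 1, ... *)
Definition path_weight n k : A :=
  if n is n'.+1 then
    bincoef2 n'.+1./2 n'./2 (if odd n' then uphalf k else k./2)
  else (k == 0)%:R.

Lemma path_weightS0 n :
  path_weight n.+1 0 = path_weight n 0 + t * path_weight n 1.
Proof.
case: n => [|n] /=.
  rewrite /bincoef2 /bincoef !big_ord1.
  by rewrite !addn0 !bin0n /= mul0n mulr0 mul0r expr0 mulr1.
rewrite uphalf_half; case: (odd n) => /=; rewrite ?add1n ?add0n.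
  exact: bincoef2Sr.
by rewrite bincoef2S0; ring.
Qed.

(** For positive length, two adjacent heights among [k], [k.+1], [k.+2] share the same index j. The
    level weight merges with that neighbour's weight, leaving [bincoef2Sl] or [bincoef2Sr]. *)
Lemma path_weightSS n k : path_weight n.+1 k.+1 =
  (if odd k then t else 1) * path_weight n k
  + (-1) ^+ k.+1 * (1 - t) * path_weight n k.+1
  + (if odd k then t else 1) * path_weight n k.+2.
Proof.
rewrite -signr_odd.
case: n => [|n] /=.
  rewrite /bincoef2 /bincoef !big_ord1 !bin0n !muln1.
  by case: k => [|k] /=; rewrite ?mul0r ?mulr0 ?expr0 ?mulr1 ?addr0.
rewrite (uphalf_half n) (uphalf_half k).
case: (odd n); case: (odd k) => /=; rewrite ?add1n ?add0n;
  by rewrite ?bincoef2Sr ?bincoef2Sl; ring.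
Qed.

End BinomialProducts.

(** * Gaussian binomials and their values at q = -1 *)

Section GaussianBinomials.
Variable F : fieldType.
Implicit Types q : F.

(** Division-free, hence continuous in q and meaningful at q = -1, where the quotient [qbinom] may
    be 0 / 0. *)
Fixpoint gauss q n k : F :=
  match n, k with
  | _, 0 => 1
  | 0, _.+1 => 0
  | n'.+1, k'.+1 => gauss q n' k' + q ^+ k'.+1 * gauss q n' k'.+1
  end.

Lemma gauss0 q n : gauss q n 0 = 1.
Proof. by case: n. Qed.

Lemma gauss_small q n k : (n < k)%N -> gauss q n k = 0.
Proof.
by elim: n k => [|n IHn] [|k] //= ltnk; rewrite !IHn ?mulr0 ?addr0 // leqW.
Qed.

(** The q-Lucas theorem at the primitive square root of unity -1. *)
Lemma gaussN1 n k :
  gauss (-1) n k = if ~~ odd n && odd k then 0 else 'C(n./2, k./2)%:R.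
Proof.
elim: n k => [|n IHn] [|k] /=; rewrite ?bin0 ?andbF //.
  by rewrite uphalf_half bin0n; case: (odd k) => //=; case: k./2.
rewrite !IHn -signr_odd /= !uphalf_half.
case: (odd n); case: (odd k) => /=; rewrite ?add1n ?add0n ?expr1 ?expr0.
- by rewrite binS natrD mul1r addrC.
- by rewrite mulN1r subrr.
- by rewrite mul1r add0r.
by rewrite mulr0 addr0.
Qed.

Lemma qintD q m n : qint q (m + n) = qint q m + q ^+ m * qint q n.
Proof.
rewrite /qint big_split_ord mulr_sumr /=; congr (_ + _).
by apply: eq_bigr => i _; rewrite exprD.
Qed.

Lemma qintN1_odd n : odd n -> qint (-1 : F) n = 1.
Proof.
move=> odd_n; rewrite -(odd_double_half n) odd_n add1n.
elim: n./2 => [|m IHm]; first by rewrite /qint big_ord1.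
rewrite doubleS /qint big_ord_recr big_ord_recr /= -/(qint _ _) IHm.
by rewrite [X in _ + X = _]exprS mulN1r addrK.
Qed.

Lemma qfactS q n : qfact q n.+1 = qfact q n * qint q n.+1.
Proof. by rewrite /qfact big_nat_recr. Qed.

Lemma qfact0 q : qfact q 0 = 1.
Proof. by rewrite /qfact big_geq. Qed.

(** The q-Pascal rule matches the splitting [k+l+2] = [k+1] + q^(k+1) [l+1]. *)
Lemma gauss_qfact q k l :
  gauss q (k + l) k * (qfact q k * qfact q l) = qfact q (k + l).
Proof.
elim: k l => [|k IHk] l; first by rewrite gauss0 qfact0 !mul1r.
elim: l => [|l IHl].
  rewrite addn0 /= (@gauss_small _ k k.+1) // mulr0 addr0 qfactS qfact0 mulr1.
  by rewrite -[in RHS](addn0 k) -IHk qfact0 addn0; ring.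
rewrite addSn /=.
transitivity (qint q k.+1 * (gauss q (k + l.+1) k * (qfact q k * qfact q l.+1))
  + q ^+ k.+1 * qint q l.+1 *
    (gauss q (k + l.+1) k.+1 * (qfact q k.+1 * qfact q l))).
  by rewrite !qfactS; ring.
rewrite IHk addnS -addSn IHl qfactS -addSn.
have -> : (k.+2 + l = k.+1 + l.+1)%N by rewrite addnS.
by rewrite qintD; ring.
Qed.

Section NonvanishingIntegers.
Variable q : F.
Hypothesis qint_neq0 : forall n, qint q n.+1 != 0.

Lemma qfact_neq0 n : qfact q n != 0.
Proof.
by elim: n => [|n IHn]; rewrite ?qfact0 ?oner_eq0 ?qfactS ?mulf_neq0.
Qed.

Lemma qbinomE n k : qbinom q n k = gauss q n k.
Proof.
rewrite /qbinom; case: leqP => [lekn|/gauss_small->//].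
rewrite -[in qfact q n](subnKC lekn) -gauss_qfact subnKC // mulfK //.
by rewrite mulf_neq0 ?qfact_neq0.
Qed.

Lemma qbinom_absorb n k :
  qbinom q n k / qint q k.+1 = qbinom q n.+1 k.+1 / qint q n.+1.
Proof.
rewrite /qbinom ltnS; case: leqP => _; last by rewrite !mul0r.
rewrite subSS !qfactS; field.
by rewrite !qfact_neq0 !qint_neq0.
Qed.

Lemma qbinom_shift n k : (k < n)%N ->
  qbinom q n k / qint q k.+1 = qbinom q n k.+1 / qint q (n - k).
Proof.
move=> ltkn; rewrite /qbinom ltkn ltnW // -(subnSK ltkn) !qfactS; field.
by rewrite !qfact_neq0 !qint_neq0.
Qed.

End NonvanishingIntegers.
End GaussianBinomials.

Arguments gauss {F} q n k.

(** * The limit of the coefficients at q = -1 *)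

Section LimitAtMinusOne.
Import Order.TTheory Num.Theory numFieldNormedType.Exports.
Local Open Scope classical_set_scope.
Variable R : realType.
Implicit Types q : R.

(** A zero of [n+1] is a root of unity, and the only real ones are 1 and -1. *)
Lemma qint_neq0 q n : q != 1 -> q != -1 -> qint q n.+1 != 0.
Proof.
move=> q1 qN1; apply/eqP => q0.
have /eqP : q ^+ n.+1 - 1 = 0 by rewrite subrX1 -/(qint q n.+1) q0 mulr0.
rewrite subr_eq0 => /eqP /(congr1 Num.norm) /eqP.
rewrite normrX normr1 pexpr_eq1 // eqr_norml.
by rewrite (negbTE q1) (negbTE qN1).
Qed.

Lemma cvg_gauss n k : gauss q n k @[q --> (-1 : R)] --> gauss (-1 : R) n k.
Proof.
elim: n k => [|n IHn] [|k] /=; try exact: cvg_cst.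
by apply: cvgD => //; apply: cvgM => //; apply: exprn_continuous.
Qed.

Lemma cvg_qint n : qint q n @[q --> (-1 : R)] --> qint (-1 : R) n.
Proof.
apply: cvg_big => [|i _]; [exact: add_continuous | exact: exprn_continuous].
Qed.

Lemma coef_qNarayana q n k : (k < n)%N -> (qNarayana n q)`_k =
  q ^+ (k ^ 2 + k) * (qbinom q n k * qbinom q n.-1 k / qint q k.+1).
Proof.
move=> ltkn; rewrite /qNarayana coef_sum (bigD1 (Ordinal ltkn)) //=.
rewrite coefZ coefXn eqxx mulr1 big1 ?addr0 ?mulrA // => i.
by rewrite -val_eqE coefZ coefXn eq_sym /= => /negbTE->; rewrite mulr0.
Qed.

Lemma lim_qNarayana n k : (k <= n)%N ->
  lim ((qNarayana n.+1 q)`_k @[q --> (-1 : R)^']) =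
  ('C(n.+1./2, uphalf k) * 'C(n./2, k./2))%:R.
Proof.
move=> lekn; apply: cvg_lim => //.
(* Once the denominator is [N] with [N] odd, it tends to 1; the power of q also tends to 1 because
   k^2 + k is even. *)
have cvg_form N i j l : odd N ->
    (forall q, q != 1 -> q != -1 -> (qNarayana n.+1 q)`_k =
       q ^+ (k ^ 2 + k) * (gauss q n.+1 i * gauss q j l / qint q N)) ->
    (qNarayana n.+1 q)`_k @[q --> (-1 : R)^'] -->
      gauss (-1 : R) n.+1 i * gauss (-1) j l.
  move=> oddN qE.
  have -> : gauss (-1 : R) n.+1 i * gauss (-1) j l = (-1) ^+ (k ^ 2 + k) *
      (gauss (-1 : R) n.+1 i * gauss (-1) j l / qint (-1) N).
    rewrite qintN1_odd // divr1 -signr_odd oddD oddX /= addbb.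
    by rewrite expr0 mul1r.
  have cvgE : q ^+ (k ^ 2 + k) * (gauss q n.+1 i * gauss q j l / qint q N)
      @[q --> (-1 : R)] --> (-1) ^+ (k ^ 2 + k) *
      (gauss (-1 : R) n.+1 i * gauss (-1) j l / qint (-1) N).
    apply: cvgM; first exact: exprn_continuous.
    apply: cvgM; first by apply: cvgM; exact: cvg_gauss.
    by apply: cvgV; [rewrite qintN1_odd ?oner_eq0 | exact: cvg_qint].
  apply: cvg_trans; last first.
    by apply: (cvg_trans _ cvgE); apply: cvg_app; exact: nbhs_dnbhs.
  apply: near_eq_cvg; near=> q; rewrite qE //.
  - near: q; apply: nbhs_dnbhs; apply: (@open_neq _ (1 : R)) => //=.
    by rewrite lt_eqF // -subr_gt0 opprK.
  - by near: q; exact: nbhs_dnbhs_neq.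
have coefE q : (qNarayana n.+1 q)`_k =
    q ^+ (k ^ 2 + k) * (qbinom q n.+1 k * qbinom q n k / qint q k.+1).
  by rewrite coef_qNarayana.
(* For even [k] the denominator [k+1] already has an odd index. *)
case odd_k: (odd k); last first.
  have odd_k1 : odd k.+1 by rewrite /= odd_k.
  have := @cvg_form _ k n k odd_k1.
  rewrite !gaussN1 odd_k !andbF uphalf_half odd_k -natrM; apply=> q q1 qN1.
  have q0 m := @qint_neq0 q m q1 qN1.
  by rewrite coefE !qbinomE.
(* For odd [k], the denominator becomes [n+1-k] if [n] is odd and [n+1] if [n] is even. *)
case odd_n: (odd n).
  have odd_nk : odd (n.+1 - k) by rewrite oddB 1?leqW //= odd_k odd_n.
  have := @cvg_form _ k.+1 n k odd_nk.
  rewrite !gaussN1 /= odd_k odd_n /= -natrM; apply=> q q1 qN1.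
  have q0 m := @qint_neq0 q m q1 qN1.
  by rewrite coefE mulrAC qbinom_shift // !qbinomE // mulrAC.
have odd_n1 : odd n.+1 by rewrite /= odd_n.
have := @cvg_form _ k n.+1 k.+1 odd_n1.
rewrite !gaussN1 odd_n1 /= -natrM mulnC uphalf_half odd_n.
apply=> q q1 qN1.
have q0 m := @qint_neq0 q m q1 qN1.
by rewrite coefE -mulrA qbinom_absorb // !qbinomE // mulrA.
Unshelve. all: end_near.
Qed.
End LimitAtMinusOne.

(** * Identification of c_n(t) with the path weights *)

Lemma coef_bincoef (R : comNzRingType) m p (b : bool) k :
  (bincoef {poly R} 'X m p b)`_k =
  if odd k == b then ('C(m, uphalf k) * 'C(p, k./2))%:R else 0.
Proof.
rewrite (@bincoef_widen _ _ (p + k./2).+1) ?ltnS ?leq_addr // coef_sum.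
under eq_bigr do rewrite mulr_natl coefMn coefXn.
(* The exponent [i.*2 + b] equals [k] only if [b] is the parity of [k] and [i = k./2], so at most
   one term survives. *)
case: eqP => [odd_k|odd_k]; last first.
  rewrite big1 // => i _; case: eqP => [k_eq|_]; last by rewrite mul0rn.
  by case: odd_k; rewrite k_eq oddD odd_double; case: (b).
have k_lt : (k./2 < (p + k./2).+1)%N by rewrite ltnS leq_addl.
rewrite (bigD1 (Ordinal k_lt)) //= big1 ?addr0 => [|i].
  rewrite uphalf_half odd_k [(b + _)%N]addnC.
  by rewrite -[k in k == _]odd_double_half odd_k addnC eqxx.
rewrite -val_eqE /= => i_neq; case: eqP => [k_eq|_]; last by rewrite mul0rn.
case/eqP: i_neq; apply/esym.
by rewrite [LHS](congr1 half k_eq) addnC half_bit_double.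
Qed.

Lemma qNarayana_m1E (R : realType) n :
  qNarayana_m1 R n = path_weight {poly R} 'X n 0.
Proof.
case: n => [//|n]; apply/polyP => k.
rewrite /= coef_poly /bincoef2 if_same coefD.
rewrite (@coef_bincoef _ _ _ false) (@coef_bincoef _ _ _ true).
(* The cutoff of [\poly_] is harmless: beyond it one of the binomials vanishes. *)
have -> : ('C(n.+1./2, uphalf k) * 'C(n./2, k./2) =
    if k < n.+1 then 'C(n.+1./2, uphalf k) * 'C(n./2, k./2) else 0)%N.
  case: ltnP => // ltnk.
  have [ltnk2|] := ltnP n./2 k./2; first by rewrite (bin_small ltnk2) muln0.
  by move=> le_k2; rewrite bin_small //; lia.
case: ltnP => [lekn|_]; last by rewrite !if_same addr0.
by rewrite lim_qNarayana //; case: (odd k); rewrite /= ?addr0 ?add0r.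
Qed.

Theorem theorem2 (R : realType) :
  has_jfrac (fun n : nat => qNarayana_m1 R n)
    (fun n : nat => if n is 0%N then 1 else (-1) ^+ n * (1 - 'X))
    (fun _ : nat => 'X).
Proof.
have -> : (fun n => qNarayana_m1 R n) = path_weight {poly R} 'X ^~ 0%N.
  by apply/funext => n; exact: qNarayana_m1E.
(* Up and down weights alternate in opposite phase, so their product at each height is ['X]. *)
pose w (b : bool) : {poly R} := if b then 'X else 1.
apply: (@has_jfrac_paths _ _ _ (fun k => w (odd k)) (fun k => w (~~ odd k))).
- by move=> k; rewrite /w; case: (odd k); rewrite ?mul1r ?mulr1.
- by [].
- by move=> n; rewrite path_weightS0 mul1r.
by move=> n k; rewrite path_weightSS /w /= negbK.
Qed.
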